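(* Let $m,n \geq k \geq 1$ be integers, and let $A,B \in \mathbb{R}^{m \times n}$. Then all matrices in the interval hull $\mathbb{I}(A,B)$ are totally non-negative of order $k$ if and only if the matrices in the finite set $\{ I_{z,z'}(A,B) : z \in \{\pm 1\}^m,\ z' \in \{\pm 1\}^n \}$ are all totally non-negative of order $k$.
   Context: A real matrix is totally non-negative of order $k$ ($TN_k$) if all its minors of order (size) at most $k$ are non-negative. For $A=(a_{ij}), B=(b_{ij}) \in \mathbb{R}^{m \times n}$, the interval hull is $$\mathbb{I}(A,B) = \{C \in \mathbb{R}^{m \times n} : c_{ij} = t_{ij} a_{ij} + (1-t_{ij}) b_{ij},\ t_{ij} \in [0,1]\},$$ where the $t_{ij}$ may vary independently over the entries $(i,j)$. For a matrix $M$, $|M|$ denotes the entrywise absolute value, $|M|_{ij} := |m_{ij}|$. For $z \in \{\pm 1\}^p$, $D_z$ is the $p \times p$ diagonal matrix with $(i,i)$ entry $z_i$. For $z \in \{\pm 1\}^m$, $z' \in \{\pm 1\}^n$, define $$I_{z,z'}(A,B) := \frac{A+B}{2} - D_z \frac{|A-B|}{2} D_{z'} .$$ *)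

(* Defs.v *)
From mathcomp Require Import all_boot all_order all_algebra.
From mathcomp Require Import classical_sets reals.
Set Implicit Arguments.
Unset Strict Implicit.
Unset Printing Implicit Defensive.
Import Order.TTheory GRing.Theory Num.Theory.
Local Open Scope classical_set_scope.
Local Open Scope ring_scope.

(* A minor of size p is given by the row and column indices listed in strictly
   increasing order. *)
Definition TN (R : realType) (m n k : nat) : set 'M[R]_(m, n) :=
  [set M | forall (p : nat) (f : 'I_p -> 'I_m) (g : 'I_p -> 'I_n),
     (1 <= p <= k)%N ->
     (forall i j : 'I_p, (i < j)%N -> (f i < f j)%N) ->
     (forall i j : 'I_p, (i < j)%N -> (g i < g j)%N) ->
     0 <= \det (mxsub f g M)].

Definition interval_hull (R : realType) (m n : nat) (A B : 'M[R]_(m, n)) :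
    set 'M[R]_(m, n) :=
  [set C | exists t : 'M[R]_(m, n),
     (forall i j, 0 <= t i j <= 1) /\
     (forall i j, C i j = t i j * A i j + (1 - t i j) * B i j)].

Definition absmx (R : realType) (m n : nat) (M : 'M[R]_(m, n)) :
    'M[R]_(m, n) := map_mx (fun x : R => `|x|) M.

Definition sign_vectors (R : realType) (p : nat) : set 'rV[R]_p :=
  [set z | forall i, z 0 i = 1 \/ z 0 i = -1].

Definition interval_vertex (R : realType) (m n : nat) (A B : 'M[R]_(m, n))
    (z : 'rV[R]_m) (z' : 'rV[R]_n) : 'M[R]_(m, n) :=
  2^-1 *: (A + B) - diag_mx z *m (2^-1 *: absmx (A - B)) *m diag_mx z'.

Arguments TN {R m n} k.
Arguments sign_vectors R p : clear implicits.

(* Main.v *)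
Require Import Defs.
From mathcomp Require Import all_boot all_order all_algebra.
From mathcomp Require Import classical_sets reals.
From mathcomp Require Import ring lra.
Set Implicit Arguments.
Unset Strict Implicit.
Unset Printing Implicit Defensive.
Import Order.TTheory GRing.Theory Num.Theory.
Local Open Scope classical_set_scope.
Local Open Scope ring_scope.

(** The determinant is affine in each entry, with slope the cofactor, that is,
    [(-1) ^+ (i + j)] times a minor of order one less. By induction on the
    order, these smaller minors are non-negative on the whole hull, so a minor
    is monotone in each of its entries with checkerboard direction, and its
    minimum over the hull is attained at the vertex whose sign vectors
    alternate along the chosen rows and columns. *)

(** Each entry of [C] ranges over the segment between [A i j] and [B i j], here given by midpoint
    and radius, which does not depend on which endpoint is larger. *)
Lemma interval_hullP (R : realType) (m n : nat) (A B C : 'M[R]_(m, n)) :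
  interval_hull A B C <->
  (forall i j, `|C i j - 2^-1 * (A i j + B i j)| <= 2^-1 * `|A i j - B i j|).
Proof.
split=> [[t [t01 tC]] i j | hC].
  have /andP[t0 t1] := t01 i j.
  have -> : C i j - 2^-1 * (A i j + B i j) = (t i j - 2^-1) * (A i j - B i j).
    by rewrite tC; field.
  by rewrite normrM; apply: ler_wpM2r => //; rewrite ler_norml; apply/andP; split; lra.
(* Where [A i j = B i j], division by zero makes this weight [0]; the radius is then zero too, which
   forces [C i j = B i j]. *)
exists (\matrix_(i, j) ((C i j - B i j) / (A i j - B i j))).
split=> i j; rewrite mxE; have := hC i j; move: (A i j) (B i j) (C i j) => a b c.
  have [ab|ba|->] := ltgtP a b; last by rewrite subrr invr0 mulr0 lexx ler01.
    rewrite [`|a - b|]ltr0_norm ?subr_lt0 // ler_norml => /andP[h1 h2].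
    rewrite -mulrNN -invrN opprB; apply/andP; split.
      by rewrite divr_ge0; lra.
    by rewrite ler_pdivrMr ?subr_gt0 //; lra.
  rewrite [`|a - b|]gtr0_norm ?subr_gt0 // ler_norml => /andP[h1 h2].
  apply/andP; split; first by rewrite divr_ge0; lra.
  by rewrite ler_pdivrMr ?subr_gt0 //; lra.
have [->|ab] := eqVneq a b.
  by rewrite !subrr normr0 mulr0 normr_le0 => /eqP; lra.
by move=> _; field; rewrite subr_eq0.
Qed.

Lemma interval_vertexE (R : realType) (m n : nat) (A B : 'M[R]_(m, n)) z z' i j :
  interval_vertex A B z z' i j =
  2^-1 * (A i j + B i j) - z 0 i * z' 0 j * (2^-1 * `|A i j - B i j|).
Proof.
by rewrite /interval_vertex mul_mx_diag mul_diag_mx !mxE mulrAC.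
Qed.

Lemma interval_vertex_hull (R : realType) (m n : nat) (A B : 'M[R]_(m, n)) z z' :
  sign_vectors R m z -> sign_vectors R n z' ->
  interval_hull A B (interval_vertex A B z z').
Proof.
move=> hz hz'; apply/interval_hullP => i j.
rewrite interval_vertexE addrC addKr normrN !normrM normr_id [`|2^-1|]ger0_norm ?invr_ge0 ?ler0n //.
by case: (hz i) => ->; case: (hz' j) => ->; rewrite ?normrN normr1 !mul1r.
Qed.

(** By injectivity an index in the image of [f] inherits the parity of its only preimage; all other
    indices get sign [1]. *)
Lemma alternating_sign_vector (R : realType) (p m : nat) (f : 'I_p -> 'I_m) :
  injective f ->
  exists2 z, sign_vectors R m z & forall i, z 0 (f i) = (-1) ^+ i.
Proof.
move=> f_inj.
exists (\row_r (-1) ^+ [exists i : 'I_p, (f i == r) && odd i]) => [r|i].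
  by rewrite mxE; case: [exists _, _]; [right | left].
rewrite mxE -[in RHS]signr_odd; congr (_ ^+ nat_of_bool _).
apply/existsP/idP => [[j /andP[/eqP /f_inj -> //]]|odd_i].
by exists i; rewrite eqxx.
Qed.

(** The cofactors along row [i] do not involve row [i], so in the expansion along that row only the
    term at [j] changes. *)
Lemma det_update_entry (R : comNzRingType) (p : nat) (W U : 'M[R]_p) i j :
  (forall i' j', (i', j') != (i, j) -> U i' j' = W i' j') ->
  \det U = \det W + (U i j - W i j) * cofactor W i j.
Proof.
move=> UW.
have cofE j' : cofactor U i j' = cofactor W i j'.
  congr (_ * \det _); apply/matrixP => a b; rewrite !mxE UW //.
  by rewrite xpair_eqE negb_and eq_sym neq_lift.
rewrite (expand_det_row U i) (expand_det_row W i) (bigD1 j) //=.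
rewrite [in RHS](bigD1 j) //= cofE mulrBl.
rewrite (eq_bigr (fun j' => W i j' * cofactor W i j')) => [|j' nj]; first by ring.
by rewrite cofE UW // xpair_eqE negb_and nj orbT.
Qed.

(** Entries of [V] are replaced by those of [C] one at a time, and no replacement lowers the
    determinant. The intermediate matrices mix entries of [V] and [C], hence the hypothesis on all
    such [W]. *)
Lemma ler_det_checkerboard (R : realDomainType) (p : nat) (V C : 'M[R]_p) :
  (forall i j : 'I_p, 0 <= (-1) ^+ (i + j) * (C i j - V i j)) ->
  (forall W : 'M[R]_p, (forall i j, W i j = V i j \/ W i j = C i j) ->
     forall i j, 0 <= \det (row' i (col' j W))) ->
  \det V <= \det C.
Proof.
move=> VC minor_ge0.
suff H N : forall W : 'M[R]_p, (forall i j, W i j = V i j \/ W i j = C i j) ->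
    (#|[set x : 'I_p * 'I_p | W x.1 x.2 != C x.1 x.2]%SET| <= N)%N ->
    \det W <= \det C.
  by apply: (H _ V) (leqnn _) => i j; left.
elim: N => [|N IHN] W WVC.
  rewrite leqn0 cards_eq0 => /eqP/setP W0.
  suff -> : W = C by [].
  apply/matrixP => i j; apply/eqP; have := W0 (i, j).
  by rewrite !inE => /negbFE.
have [/eqP|[[i j]]] := set_0Vmem [set x : 'I_p * 'I_p | W x.1 x.2 != C x.1 x.2]%SET.
  by rewrite -cards_eq0 => /eqP W0 _; apply: IHN => //; rewrite W0.
move=> ijW cardW.
have WVij : W i j = V i j.
  by case: (WVC i j) => // E; move: ijW; rewrite inE /= E eqxx.
pose U : 'M_p := \matrix_(a, b) if (a, b) == (i, j) then C a b else W a b.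
apply: (@le_trans _ _ (\det U)).
  rewrite (@det_update_entry _ _ W U i j) => [|a b /negbTE nab]; last by rewrite mxE nab.
  (* The sign in the cofactor is moved onto [C i j - V i j], leaving a bare minor of [W]. *)
  rewrite lerDl mxE eqxx WVij mulrCA mulrA mulr_ge0 ?VC //.
  exact: minor_ge0.
apply: IHN => [a b|].
  by rewrite mxE; case: eqP => _; [right | apply: WVC].
rewrite -ltnS; apply: leq_trans cardW; apply: proper_card; apply/properP; split.
  apply/fintype.subsetP => -[a b]; rewrite !inE /= mxE.
  by case: ifP => _ //; rewrite eqxx.
by exists (i, j) => //; rewrite inE /= mxE !eqxx.
Qed.

Lemma increasing_inj (p m : nat) (f : 'I_p -> 'I_m) :
  (forall i j : 'I_p, (i < j)%N -> (f i < f j)%N) -> injective f.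
Proof.
move=> f_inc i j /(congr1 val) /= fij; apply: val_inj.
by case: (ltngtP i j) => // /f_inc; rewrite fij ltnn.
Qed.

Lemma increasing_lift (p m : nat) (f : 'I_p.+1 -> 'I_m) (h : 'I_p.+1) :
  (forall i j : 'I_p.+1, (i < j)%N -> (f i < f j)%N) ->
  forall i j : 'I_p, (i < j)%N -> (f (lift h i) < f (lift h j))%N.
Proof.
move=> f_inc i j ij; apply: f_inc; rewrite /= /bump.
by rewrite -addnS leq_add //; case: (leqP h i) => // hi; rewrite (leq_trans hi (ltnW ij)).
Qed.

(** Taking the hull of the submatrices lets the induction reach mixed matrices without extending
    them to size [m] by [n]. It starts at the empty determinant, which is [1]. *)
Lemma det_hull_ge0 (R : realType) (m n k : nat) (A B : 'M[R]_(m, n)) :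
  (forall z z', sign_vectors R m z -> sign_vectors R n z' ->
     TN k (interval_vertex A B z z')) ->
  forall p (f : 'I_p -> 'I_m) (g : 'I_p -> 'I_n), (p <= k)%N ->
  (forall i j : 'I_p, (i < j)%N -> (f i < f j)%N) ->
  (forall i j : 'I_p, (i < j)%N -> (g i < g j)%N) ->
  forall C, interval_hull (mxsub f g A) (mxsub f g B) C -> 0 <= \det C.
Proof.
move=> vertexTN; elim=> [|p IHp] f g pk f_inc g_inc C /interval_hullP hC.
  by rewrite det_mx00.
have [z hz zf] := alternating_sign_vector R (increasing_inj f_inc).
have [z' hz' zg] := alternating_sign_vector R (increasing_inj g_inc).
apply: (le_trans (vertexTN z z' hz hz' p.+1 f g pk f_inc g_inc)).
have /interval_hullP hV := interval_vertex_hull A B hz hz'.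
apply: ler_det_checkerboard => [i j|W WVC i j].
  (* The vertex entry is the midpoint minus [(-1) ^+ (i + j)] times the radius: the lower endpoint
     when [i + j] is even, the upper one when it is odd. *)
  have := hC i j; rewrite ![mxsub _ _ _ _ _]mxE interval_vertexE zf zg -exprD.
  rewrite ler_norml => /andP[h1 h2].
  by rewrite -signr_odd; case: odd; rewrite ?expr0 ?expr1; lra.
apply: (IHp (f \o lift i) (g \o lift j) (ltnW pk)).
- exact: increasing_lift.
- exact: increasing_lift.
apply/interval_hullP => a b; have := hC (lift i a) (lift j b).
have := hV (f (lift i a)) (g (lift j b)).
by case: (WVC (lift i a) (lift j b)); rewrite !mxE => ->.
Qed.

Theorem theoremD (R : realType) (m n k : nat) (hk : (1 <= k)%N)
    (hkm : (k <= m)%N) (hkn : (k <= n)%N) (A B : 'M[R]_(m, n)) :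
  (forall C : 'M[R]_(m, n), interval_hull A B C -> TN k C) <->
  (forall C : 'M[R]_(m, n),
     [set interval_vertex A B z z' | z in sign_vectors R m
                                   & z' in sign_vectors R n] C -> TN k C).
Proof.
split=> [hullTN _ [z hz [z' hz' <-]] | vertexTN C /interval_hullP hC].
  exact/hullTN/interval_vertex_hull.
move=> p f g /andP[_ pk] f_inc g_inc.
apply: (@det_hull_ge0 _ _ _ k A B _ p f g pk f_inc g_inc) => [z z' hz hz'|].
  by apply: vertexTN; exists z => //; exists z'.
by apply/interval_hullP => i j; rewrite !mxE.
Qed.
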